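(* Let $\mathcal{M}=\{M^x: x\in\Lambda\}$ be a standard log-convex weight matrix, let $r,s\in\mathbb{N}_{>0}$ and let $U\subseteq\mathbb{R}^r$ be a non-empty open set. (Roumieu case) Assume that (L) for all $C>0$ and $x\in\Lambda$ there exist $D>0$ and $y\in\Lambda$ with $C^kM^x_k\le D M^y_k$ for all $k\in\mathbb{N}$, and (mg) for all $x\in\Lambda$ there exist $C>0$ and $y_1,y_2\in\Lambda$ with $M^x_{j+k}\le C^{j+k}M^{y_1}_jM^{y_2}_k$ for all $j,k\in\mathbb{N}$. Then $\mathcal{E}_{\{\mathcal{M}\}}(U,\mathbb{R}^s)=\mathcal{E}_{\{\omega_{\mathcal{M}}\}}(U,\mathbb{R}^s)$ as locally convex vector spaces. (Beurling case) Assume that (L) for all $C>0$ and $x\in\Lambda$ there exist $D>0$ and $y\in\Lambda$ with $C^kM^y_k\le D M^x_k$ for all $k\in\mathbb{N}$, and (mg) for all $x_1,x_2\in\Lambda$ there exist $C>0$ and $y\in\Lambda$ with $M^y_{j+k}\le C^{j+k}M^{x_1}_jM^{x_2}_k$ for all $j,k\in\mathbb{N}$. Then $\mathcal{E}_{(\mathcal{M})}(U,\mathbb{R}^s)=\mathcal{E}_{(\omega_{\mathcal{M}})}(U,\mathbb{R}^s)$ as locally convex vector spaces.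
   Context: $\mathbb{N}=\{0,1,2,\dots\}$. A weight sequence is $M=(M_k)_{k\in\mathbb{N}}$ with $M_k>0$. It is normalized if $1=M_0\le M_1$, log-convex if $M_j^2\le M_{j-1}M_{j+1}$ for all $j\ge1$. $\mathcal{LC}$ is the set of normalized log-convex $M$ with $\lim_{k\to\infty}(M_k)^{1/k}=+\infty$. $(\Lambda,\le)$ is a partially ordered set which is both upward and downward directed. A weight matrix is a family $\mathcal{M}=\{M^x:x\in\Lambda\}$ of normalized, increasing weight sequences with $M^x\le M^y$ (termwise) for $x\le y$. It is standard log-convex if moreover every $M^x\in\mathcal{LC}$. Associated function: $\omega_M(t):=\sup_{p\in\mathbb{N}}\log(t^p/M_p)$ for $t>0$, $\omega_M(0):=0$ (here $M_0=1$). For a function $\omega$ on $[0,\infty)$ put $\varphi_\omega(y):=\omega(e^y)$ and $\varphi^*_\omega(x):=\sup\{xy-\varphi_\omega(y):y\ge0\}$, $x\ge 0$. For compact $K\subset\mathbb{R}^r$ with smooth boundary, $\mathcal{E}(K,\mathbb{R}^s)$ is the space of smooth functions on the interior of $K$ all of whose derivatives extend continuously to $K$. With $f^{(k)}$ the $k$-th Fréchet derivative and the operator norm on $k$-linear maps, put $$\|f\|_{M,K,h}:=\sup_{k\in\mathbb{N},x\in K}\frac{\|f^{(k)}(x)\|_{L^k(\mathbb{R}^r,\mathbb{R}^s)}}{h^kM_k},\qquad \|f\|_{\omega,K,l}:=\sup_{k\in\mathbb{N},x\in K}\frac{\|f^{(k)}(x)\|_{L^k(\mathbb{R}^r,\mathbb{R}^s)}}{\exp(\frac1l\varphi^*_\omega(lk))},$$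 and let $\mathcal{E}_{M,h}(K,\mathbb{R}^s)$, $\mathcal{E}_{\omega,l}(K,\mathbb{R}^s)$ be the Banach spaces of $f\in\mathcal{E}(K,\mathbb{R}^s)$ for which the respective norm is finite. Define the locally convex spaces (limits over compact $K\subset U$ with smooth boundary) $$\mathcal{E}_{\{\mathcal{M}\}}(U,\mathbb{R}^s)=\varprojlim_{K}\varinjlim_{x\in\Lambda,h>0}\mathcal{E}_{M^x,h}(K,\mathbb{R}^s),\quad \mathcal{E}_{(\mathcal{M})}(U,\mathbb{R}^s)=\varprojlim_{K}\varprojlim_{x\in\Lambda,h>0}\mathcal{E}_{M^x,h}(K,\mathbb{R}^s),$$ $$\mathcal{E}_{\{\omega_{\mathcal{M}}\}}(U,\mathbb{R}^s)=\varprojlim_{K}\varinjlim_{x\in\Lambda,l>0}\mathcal{E}_{\omega_{M^x},l}(K,\mathbb{R}^s),\quad \mathcal{E}_{(\omega_{\mathcal{M}})}(U,\mathbb{R}^s)=\varprojlim_{K}\varprojlim_{x\in\Lambda,l>0}\mathcal{E}_{\omega_{M^x},l}(K,\mathbb{R}^s).$$ As sets these consist of the smooth $f:U\to\mathbb{R}^s$ such that for all compact $K\subset U$ the corresponding norm is finite for some (Roumieu, braces) respectively all (Beurling, parentheses) values of the parameters. *)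

(* Defs.v *)
From mathcomp Require Import all_boot all_order all_algebra.
From mathcomp Require Import all_classical all_reals all_analysis.

Set Implicit Arguments.
Unset Strict Implicit.
Unset Printing Implicit Defensive.

Import Order.TTheory GRing.Theory Num.Theory.
Import numFieldNormedType.Exports.

Local Open Scope classical_set_scope.
Local Open Scope ring_scope.

(** * Weight sequences and weight matrices *)

Section WeightSequences.
Context {R : realType}.
Implicit Types (N : nat -> R) (omega : R -> R).

Definition weight_sequence N := forall k, 0 < N k.

Definition normalized N := N 0%N = 1 /\ 1 <= N 1%N.

Definition log_convex N := forall j, N j.+1 ^+ 2 <= N j * N j.+2.

Definition increasing N := forall k, N k <= N k.+1.

Definition LC N :=
  [/\ weight_sequence N, normalized N, log_convex N
    & (fun k => N k `^ (k%:R)^-1) @ \oo --> +oo].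

(* For [N] in [LC] both suprema below are finite, so that the real-valued [sup]
   (which is 0 on unbounded sets) is the supremum in the usual sense. *)
Definition assoc_fun N (t : R) : R :=
  if 0 < t then sup [set ln (t ^+ p / N p) | p in [set: nat]] else 0.

Definition phi omega (y : R) : R := omega (expR y).

Definition phi_star omega (x : R) : R :=
  sup [set x * y - phi omega y | y in [set y | 0 <= y]].

End WeightSequences.

Section WeightMatrices.
Context {R : realType} {d : Order.disp_t} {Lambda : porderType d}.
Implicit Type M : Lambda -> nat -> R.

Definition upward_directed (d' : Order.disp_t) (T : porderType d') :=
  forall x y : T, exists z, (x <= z)%O /\ (y <= z)%O.

Definition downward_directed (d' : Order.disp_t) (T : porderType d') :=
  forall x y : T, exists z, (z <= x)%O /\ (z <= y)%O.

Definition weight_matrix M :=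
  [/\ upward_directed Lambda, downward_directed Lambda,
      forall x, [/\ weight_sequence (M x), normalized (M x) & increasing (M x)]
    & forall x y, (x <= y)%O -> forall k, M x k <= M y k].

Definition standard_log_convex M := weight_matrix M /\ forall x, LC (M x).

Definition condL_roumieu M :=
  forall (C : R) x, 0 < C -> exists (D : R) y,
    0 < D /\ forall k, C ^+ k * M x k <= D * M y k.

Definition condmg_roumieu M :=
  forall x, exists (C : R) y1 y2,
    0 < C /\ forall j k, M x (j + k)%N <= C ^+ (j + k) * M y1 j * M y2 k.

Definition condL_beurling M :=
  forall (C : R) x, 0 < C -> exists (D : R) y,
    0 < D /\ forall k, C ^+ k * M y k <= D * M x k.

Definition condmg_beurling M :=
  forall x1 x2, exists (C : R) y,
    0 < C /\ forall j k, M y (j + k)%N <= C ^+ (j + k) * M x1 j * M x2 k.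

End WeightMatrices.

(** * Locally convex spaces inside an ambient vector space *)

(* A vector subspace of [V] together with the family of its open sets. All the
   spaces under consideration are spaces of functions, realized in one ambient
   space; [X = Y] then says that [X] and [Y] have the same elements and the same
   open sets. *)
Record topspace (R : realType) (V : lmodType R) := TopSpace {
  vectors : set V;
  opens : set (set V)
}.

Section LocallyConvex.
Context {R : realType}.

(* In the library a [tvsType] is by definition locally convex; [X] is locally
   convex if it is the image of one of these under a linear embedding. *)
Definition locally_convex_space (V : lmodType R) (X : topspace V) :=
  exists (T : tvsType R) (i : {linear T -> V}),
    [/\ injective i, range i = vectors X
      & opens X = [set i @` O | O in [set O : set T | open O]]].

Definition map_continuous (V W : lmodType R) (X : topspace V) (Y : topspace W)
    (rho : V -> W) :=
  forall O, opens Y O -> opens X (vectors X `&` rho @^-1` O).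

Definition normed_space (V : lmodType R) (E : set V) (nrm : V -> \bar R) :
    topspace V :=
  let F := [set f | E f /\ (nrm f < +oo)%E] in
  TopSpace F [set O | O `<=` F /\ forall f, O f ->
    exists2 e : R, 0 < e & forall g, F g -> (nrm (g - f)%R < e%:E)%E -> O g].

(* Inductive limit of an increasing family of subspaces: their union with the
   finest locally convex topology making all inclusions continuous. Since that
   topology is itself one of the candidates [Y], its open sets are the sets
   which are open for some candidate. *)
Definition ind_lim (V : lmodType R) (I : Type) (D : set I)
    (X : I -> topspace V) : topspace V :=
  let F := \bigcup_(i in D) vectors (X i) in
  TopSpace F [set O | exists Y : topspace V,
    [/\ locally_convex_space Y, vectors Y = F,
        forall i, D i -> map_continuous (X i) Y id & opens Y O]].

(* Projective limit of the [X i] along maps [rho i] defined on [E]: the elements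
   of [E] sent into every [X i], with the coarsest locally convex topology
   making all [rho i] continuous (its open sets are the sets which are open for
   every candidate [Y]). *)
Definition proj_lim (V W : lmodType R) (E : set V) (I : Type) (D : set I)
    (X : I -> topspace W) (rho : I -> V -> W) : topspace V :=
  let F := [set f | E f /\ forall i, D i -> vectors (X i) (rho i f)] in
  TopSpace F [set O | forall Y : topspace V,
    locally_convex_space Y -> vectors Y = F ->
    (forall i, D i -> map_continuous Y (X i) (rho i)) -> opens Y O].

End LocallyConvex.

(** * Smooth functions *)

Section Smooth.
Context {R : realType} {r : nat}.

(* [frechet f [:: v1; ...; vk] x] is the [k]-th Frechet derivative of [f] at
   [x], applied to [(v1, ..., vk)]: evaluation at fixed [v2, ..., vk] is linear
   and continuous, so it commutes with the outermost differential. *)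
Fixpoint frechet (W : normedModType R) (f : 'rV[R]_r -> W)
    (vs : seq 'rV[R]_r) : 'rV[R]_r -> W :=
  if vs is v :: vs' then fun x => 'd (frechet f vs') x v else f.

(* Only used for finite-dimensional [W], where differentiability of the [k]-th
   derivative as a map into the [k]-linear maps amounts to differentiability of
   all its evaluations. *)
Definition smooth_on (W : normedModType R) (A : set 'rV[R]_r)
    (f : 'rV[R]_r -> W) :=
  forall (vs : seq 'rV[R]_r) x, A x -> differentiable (frechet f vs) x.

(* Near each of its boundary points, [K] is a sublevel set of a smooth function
   with nonvanishing differential. *)
Definition smooth_boundary (K : set 'rV[R]_r) :=
  forall p, closure K p -> ~ interior K p ->
    exists (V : set 'rV[R]_r) (rho : 'rV[R]_r -> R^o),
      [/\ open V, V p, smooth_on V rho,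
          exists v, 'd rho p v != 0
        & K `&` V = [set x | V x /\ rho x <= 0]].

Definition euclidean_norm (n : nat) (v : 'rV[R]_n) : R :=
  Num.sqrt (\sum_i v ord0 i ^+ 2).

Section Valued.
Context {s : nat}.
Notation fct := ('rV[R]_r -> 'rV[R]_s).
Implicit Types (f : fct) (K A U : set 'rV[R]_r) (w : nat -> R).

(* A function on an open set [A] is encoded by its extension by 0 to the whole
   space, so that equality of functions on [A] is equality. *)
Definition smooth_fun A : set fct :=
  [set f | smooth_on A f /\ forall x, ~ A x -> f x = 0].

Definition restriction K f : fct := patch (fun=> 0) (interior K) f.

Definition smooth_fun_cpt K : set fct :=
  [set f | smooth_fun (interior K) f /\
    forall vs : seq 'rV[R]_r, exists2 g : fct, {within K, continuous g} &
      forall x, interior K x -> g x = frechet f vs x].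

(* The continuous extension to [K] of the derivative of [f] on the interior. *)
Definition frechet_cpt K f (vs : seq 'rV[R]_r) (x : 'rV[R]_r) : 'rV[R]_s :=
  lim (frechet f vs @ within (interior K) (nbhs x)).

Definition operator_norm K f (k : nat) (x : 'rV[R]_r) : \bar R :=
  ereal_sup [set (euclidean_norm (frechet_cpt K f vs x))%:E |
    vs in [set vs : k.-tuple 'rV[R]_r |
             forall v, v \in vs -> euclidean_norm v <= 1]].

(* [||f||_{M,K,h}] and [||f||_{omega,K,l}] are the cases [w = weight_M M h] and
   [w = weight_omega omega l]. For empty [K] the supremum is [-oo] instead
   of 0, which is harmless as the space then only contains 0. *)
Definition weighted_norm K w f : \bar R :=
  ereal_sup [set (operator_norm K f kx.1 kx.2 * ((w kx.1)^-1)%:E)%E |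
    kx in [set: nat] `*` K].

Definition weighted_space K w : topspace fct :=
  normed_space (smooth_fun_cpt K) (weighted_norm K w).

End Valued.
End Smooth.

(** * Ultradifferentiable classes *)

Section Classes.
Context {R : realType}.

Definition weight_M (N : nat -> R) (h : R) (k : nat) : R := h ^+ k * N k.

Definition weight_omega (omega : R -> R) (l : R) (k : nat) : R :=
  expR (l^-1 * phi_star omega (l * k%:R)).

Context {Lambda : Type} {r : nat}.

Definition admissible_compact (U : set 'rV[R]_r) : set (set 'rV[R]_r) :=
  [set K | [/\ compact K, smooth_boundary K & K `<=` U]].

Definition parameters : set (Lambda * R) := [set p | 0 < p.2].

(* [w x a] is the weight with index [x] and parameter [a] ([h] or [l]). *)
Definition roumieu (w : Lambda -> R -> nat -> R) (U : set 'rV[R]_r) (s : nat) :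
    topspace ('rV[R]_r -> 'rV[R]_s) :=
  proj_lim (smooth_fun U) (admissible_compact U)
    (fun K => ind_lim parameters (fun p => weighted_space K (w p.1 p.2)))
    restriction.

Definition beurling (w : Lambda -> R -> nat -> R) (U : set 'rV[R]_r) (s : nat) :
    topspace ('rV[R]_r -> 'rV[R]_s) :=
  proj_lim (smooth_fun U) (admissible_compact U)
    (fun K => proj_lim (smooth_fun_cpt K) parameters
                (fun p => weighted_space K (w p.1 p.2)) (fun=> id))
    restriction.

Definition E_roumieu (M : Lambda -> nat -> R) :=
  roumieu (fun x => weight_M (M x)).

Definition E_beurling (M : Lambda -> nat -> R) :=
  beurling (fun x => weight_M (M x)).

Definition E_omega_roumieu (M : Lambda -> nat -> R) :=
  roumieu (fun x => weight_omega (assoc_fun (M x))).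

Definition E_omega_beurling (M : Lambda -> nat -> R) :=
  beurling (fun x => weight_omega (assoc_fun (M x))).

End Classes.

(* Main.v *)
(* Write W^l_k = exp (phi^* (l k) / l) for the weights built from omega_N, where N
   is in LC. Then W^1_k = N_k, and W^l_k increases with l because phi >= 0.
   Hence (L) absorbs the factors h^k of the weights of E_M into a change of
   index at l = 1. Conversely, iterating (mg) gives:
   - Roumieu: for l <= n, (W^l_k)^n <= N_{nk} is bounded by (C^k N'_k)^n;
   - Beurling: for l >= 1/n and k = n j + i with i < n, W^l_k >= (N_j)^n, while
     N'_k <= C^k (N_j)^n N_i and N_i <= N_n.
   So the Banach spaces of the two families over a fixed K embed continuously
   into each other cofinally, and the limits coincide. *)

Require Import Defs.
From mathcomp Require Import all_boot all_order all_algebra.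
From mathcomp Require Import all_classical all_reals all_analysis.
From mathcomp Require Import ring.

Import Order.TTheory GRing.Theory Num.Theory.
Import numFieldNormedType.Exports.

Local Open Scope classical_set_scope.
Local Open Scope ring_scope.

(** * Continuous inclusions and cofinal families in limits *)

Definition embedded {R : realType} {V : lmodType R} (X Y : topspace V) :=
  vectors X `<=` vectors Y /\ map_continuous X Y id.

Lemma map_continuous_embedded {R : realType} {V W : lmodType R}
    {X : topspace V} {Y Z : topspace W} {rho : V -> W} :
  (forall f, vectors X f -> vectors Y (rho f)) ->
  map_continuous X Y rho -> embedded Y Z -> map_continuous X Z rho.
Proof.
move=> XY cXY [_ cYZ] O /cYZ /cXY; congr (opens X _).
by apply/seteqP; split=> f /= [Xf]; [case|split=> //; split=> //; exact: XY].
Qed.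

Lemma embedded_map_continuous {R : realType} {V : lmodType R}
    {X Y Z : topspace V} :
  embedded X Y -> map_continuous Y Z id -> map_continuous X Z id.
Proof.
move=> [XY cXY] cYZ O /cYZ /cXY; congr (opens X _).
by apply/seteqP; split=> f /= [Xf]; [case|split=> //; split=> //; exact: XY].
Qed.

(** The unions agree, and precomposing with the embeddings shows that both families admit the same
    candidate topologies. *)
Lemma ind_lim_cofinal {R : realType} {V : lmodType R} {I : Type} {D : set I}
    {X Y : I -> topspace V} :
  (forall i, D i -> exists2 j, D j & embedded (X i) (Y j)) ->
  (forall j, D j -> exists2 i, D i & embedded (Y j) (X i)) ->
  ind_lim D X = ind_lim D Y.
Proof.
move=> XY YX; rewrite /ind_lim.
have -> : \bigcup_(i in D) vectors (X i) = \bigcup_(i in D) vectors (Y i).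
  apply/seteqP; split=> f [i Di fi].
    by have [j Dj [s _]] := XY i Di; exists j => //; exact: s.
  by have [j Dj [s _]] := YX i Di; exists j => //; exact: s.
congr TopSpace; apply/seteqP; split=> O [Z [lcZ vZ cZ oZ]]; exists Z; split=> //.
  by move=> j /YX [i Di ji]; exact: embedded_map_continuous ji (cZ _ Di).
by move=> j /XY [i Di ji]; exact: embedded_map_continuous ji (cZ _ Di).
Qed.

(** Dual to the inductive case: the inclusions of a candidate into one family are composed with the
    embeddings into the other. *)
Lemma proj_lim_cofinal {R : realType} {V : lmodType R} {E : set V} {I : Type}
    {D : set I} {X Y : I -> topspace V} :
  (forall j, D j -> exists2 i, D i & embedded (X i) (Y j)) ->
  (forall i, D i -> exists2 j, D j & embedded (Y j) (X i)) ->
  proj_lim E D X (fun=> id) = proj_lim E D Y (fun=> id).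
Proof.
move=> XY YX; rewrite /proj_lim /=.
have FE : [set f | E f /\ forall i, D i -> vectors (X i) f] =
          [set f | E f /\ forall i, D i -> vectors (Y i) f].
  apply/seteqP; split=> f /= [Ef h]; split=> // i Di.
    by have [j Dj [s _]] := XY i Di; apply: s; exact: h.
  by have [j Dj [s _]] := YX i Di; apply: s; exact: h.
rewrite FE; congr TopSpace; apply/seteqP.
split=> O /= oO Z lcZ vZ cZ; apply: oO => // i Di.
  have [j Dj ji] := YX i Di.
  apply: map_continuous_embedded (cZ _ Dj) ji => f.
  by rewrite vZ => -[_]; exact.
have [j Dj ji] := XY i Di.
apply: map_continuous_embedded (cZ _ Dj) ji => f.
by rewrite vZ -FE => -[_]; exact.
Qed.

(** * Weighted norms over a fixed set [K] *)

Section WeightedSpaces.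
Context {R : realType} {r s : nat}.
Implicit Types (K : set 'rV[R]_r) (f : 'rV[R]_r -> 'rV[R]_s) (v w : nat -> R).

Lemma operator_norm_ge0 K f k x : (0 <= operator_norm K f k x)%E.
Proof.
(* Testing on the zero tuple keeps the supremum from being [-oo]. *)
apply: (@le_trans _ _ (euclidean_norm (frechet_cpt K f (nseq k 0) x))%:E).
  by rewrite lee_fin sqrtr_ge0.
apply: ereal_sup_ubound; exists [tuple of nseq k 0] => //= y.
rewrite mem_nseq => /andP[_ /eqP ->].
rewrite /euclidean_norm big1 ?sqrtr0 // => i _.
by rewrite mxE expr0n.
Qed.

Lemma weighted_norm_le {v w} {C : R} K f :
  0 < C -> (forall k, 0 < v k) -> (forall k, 0 < w k) ->
  (forall k, v k <= C * w k) ->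
  (weighted_norm K w f <= C%:E * weighted_norm K v f)%E.
Proof.
move=> C0 v0 w0 vw; apply: ge_ereal_sup => _ [[k x] [_ Kx] <-] /=.
apply: (@le_trans _ _ (C%:E * (operator_norm K f k x * (v k)^-1%:E))%E).
  rewrite muleCA; apply: lee_wpmul2l; first exact: operator_norm_ge0.
  by rewrite -EFinM lee_fin ler_pdivlMr ?v0 // ler_pdivrMl ?w0 // mulrC.
apply: lee_wpmul2l; first by rewrite lee_fin ltW.
by apply: ereal_sup_ubound; exists (k, x).
Qed.

Lemma weighted_space_embedded {v w} {C : R} K :
  0 < C -> (forall k, 0 < v k) -> (forall k, 0 < w k) ->
  (forall k, v k <= C * w k) ->
  embedded (@weighted_space R r s K v) (weighted_space K w).
Proof.
move=> C0 v0 w0 vw.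
have le f := weighted_norm_le K f C0 v0 w0 vw.
have sub : vectors (@weighted_space R r s K v) `<=` vectors (weighted_space K w).
  move=> f [Ef nf]; split=> //; apply: le_lt_trans (le f) _.
  (* The norm is [-oo] when [K] is empty, hence the extra case. *)
  by move: nf; case: (weighted_norm K v f) => [a| |] //= _;
    rewrite ?ltry // mulrNy gtr0_sg // mul1e.
split=> // O [OF oO]; split=> [f [] //|f [Ff /oO [e e0 he]]].
exists (e / C); first exact: divr_gt0.
move=> g Fg lt; split=> //; apply: he; first exact: sub.
apply: le_lt_trans (le _) _.
by rewrite -lte_pdivlMl // -EFinM mulrC.
Qed.

End WeightedSpaces.

(** * Associated function and Young conjugate of a sequence in [LC] *)

Section AssociatedFunction.
Context {R : realType}.
Context {N : nat -> R} (N_LC : LC N).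

Let N_gt0 k : 0 < N k. Proof. by case: N_LC => + _ _ _; exact. Qed.
Let N0 : N 0%N = 1. Proof. by case: N_LC => _ [+ _] _ _. Qed.

(** From some rank on, [t] is at most the [p]-th root of [N p], so the logarithms are nonpositive;
    finitely many others remain. *)
Lemma assoc_fun_has_ubound (t : R) : 0 < t ->
  has_ubound [set ln (t ^+ p / N p) | p in [set: nat]].
Proof.
move=> t0; case: N_LC => _ _ _ /cvgryPge /(_ t) [n _ hn].
exists (\sum_(p < n.+1) `|ln (t ^+ p / N p)|) => _ [p _ <-].
have [pn|np] := ltnP p n.+1.
  rewrite (bigD1 (Ordinal pn)) //=; apply: le_trans (ler_norm _) _.
  by rewrite lerDl sumr_ge0.
apply: (@le_trans _ _ 0); last by apply: sumr_ge0 => i _; exact: normr_ge0.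
apply: ln_le0; rewrite ler_pdivrMr // mul1r.
(* The finite sum includes the index [n], so [p] is positive here even if [n = 0], and the [p]-th
   root is genuine. *)
have p0 : (0 < p)%N by exact: leq_ltn_trans np.
have := hn p (ltnW np) => /= /(lerXn2r p).
rewrite !nnegrE (ltW t0) powR_ge0 => /(_ isT isT) /le_trans; apply.
by rewrite -powR_mulrn ?powR_ge0 // -powRrM mulVf ?pnatr_eq0 -?lt0n //
  powRr1 // ltW.
Qed.

Lemma phi_ge (y : R) p : p%:R * y - ln (N p) <= phi (assoc_fun N) y.
Proof.
rewrite /phi /assoc_fun expR_gt0.
apply: sup_upper_bound.
  by split; [exists (ln (expR y ^+ 0 / N 0)); exists 0%N
            |apply: assoc_fun_has_ubound; exact: expR_gt0].
exists p => //; rewrite ln_div ?posrE ?exprn_gt0 ?expR_gt0 //.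
by rewrite -expRM_natl mulr_natl expRK.
Qed.

Lemma phi_ge0 (y : R) : 0 <= phi (assoc_fun N) y.
Proof. by have := phi_ge y 0; rewrite N0 ln1 mul0r subr0. Qed.

(** By log-convexity the quotients [mu j] are nondecreasing. For [k <= p], N_p / N_k is a product of
    [p - k] quotients that are at least [mu k]; for [p <= k], N_k / N_p is a product of [k - p]
    quotients that are at most [mu k]. *)
Lemma log_convex_tangent k p :
  (N k.+1 / N k) ^+ p * N k <= (N k.+1 / N k) ^+ k * N p.
Proof.
pose mu j := N j.+1 / N j; rewrite -/(mu k).
have mu_gt0 j : 0 < mu j by exact: divr_gt0.
have NS j : N j.+1 = mu j * N j by rewrite divfK ?gt_eqF.
have mu_le i j : (i <= j)%N -> mu i <= mu j.
  move: i j; apply: (@homo_leq _ _ <=%R) => [//||j]; first exact: le_trans.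
  rewrite ler_pdivrMr // mulrAC ler_pdivlMr // -expr2 mulrC.
  by case: N_LC => _ _ + _; exact.
have [kp|/ltnW pk] := leqP k p.
  rewrite -(subnKC kp) exprD -mulrA ler_pM2l ?exprn_gt0 //.
  elim: (p - k)%N => [|m IHm]; first by rewrite expr0 mul1r addn0.
  rewrite exprS -mulrA addnS NS ler_pM ?(ltW (mu_gt0 _)) //.
    by rewrite mulr_ge0 ?exprn_ge0 ?(ltW (mu_gt0 _)) // ltW.
  by apply: mu_le; exact: leq_addr.
suff H m : (p + m <= k)%N -> N (p + m)%N <= mu k ^+ m * N p.
  have := H (k - p)%N; rewrite subnKC // => /(_ (leqnn k)).
  rewrite -(ler_pM2l (exprn_gt0 p (mu_gt0 k))) mulrA -exprD subnKC //.
elim: m => [_|m IHm]; first by rewrite expr0 mul1r addn0.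
rewrite addnS => pmk; rewrite NS exprS -mulrA
  ler_pM ?(ltW (mu_gt0 _)) ?(ltW (N_gt0 _)) //.
  by apply: mu_le; exact: ltnW.
exact/IHm/ltnW.
Qed.

(* By log-convexity the supremum defining [phi] at [y] is attained at [k] when
   [expR y = N k.+1 / N k]. *)
Lemma phi_attained k : 1 <= N k.+1 / N k ->
  exists2 y, 0 <= y & phi (assoc_fun N) y = k%:R * y - ln (N k).
Proof.
set t := _ / _ => t1; have t0 : 0 < t by exact: lt_le_trans t1.
exists (ln t); first exact: ln_ge0.
apply/eqP; rewrite eq_le phi_ge andbT /phi /assoc_fun expR_gt0 lnK ?posrE //.
apply: ge_sup; first by exists (ln (t ^+ 0 / N 0)); exists 0%N.
move=> _ [p _ <-].
rewrite mulr_natl -lnXn // -ln_div ?posrE ?exprn_gt0 //.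
rewrite ler_ln ?posrE ?divr_gt0 ?exprn_gt0 //.
rewrite ler_pdivrMr // mulrAC ler_pdivlMr //; exact: log_convex_tangent.
Qed.

Lemma phi_star_ge (x y : R) : 0 <= x -> 0 <= y ->
  x * y - phi (assoc_fun N) y <= phi_star (assoc_fun N) x.
Proof.
move=> x0 y0; apply: sup_upper_bound; last by exists y.
split; first by exists (x * y - phi (assoc_fun N) y); exists y.
(* Since [p.+1 > x], the term of index [p.+1] in [phi] bounds the set, so [sup] is not its default
   value 0. *)
pose p := Num.truncn x; exists (ln (N p.+1)) => _ [z z0 <-].
rewrite lerBlDr -lerBlDl; apply: le_trans (phi_ge z p.+1).
by rewrite lerD2r ler_wpM2r // ltW // truncnS_gt.
Qed.

(** Scaling by (n+1)/l >= 1 turns l k y - phi(y) into at most (n+1) k y - phi(y), because phi >= 0;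
    the term of index (n+1)k in phi bounds this by ln N_{(n+1)k}. *)
Lemma weight_omega_le (l : R) n k : 0 < l -> l <= n.+1%:R ->
  weight_omega (assoc_fun N) l k ^+ n.+1 <= N (n.+1 * k)%N.
Proof.
move=> l0 le_ln.
rewrite /weight_omega -expRM_natl -[leRHS]lnK ?posrE // ler_expR.
rewrite mulrA -ler_pdivlMl ?mulr_gt0 ?invr_gt0 //.
apply: ge_sup.
  by exists (l * k%:R * 0 - phi (assoc_fun N) 0); exists 0 => //=; exact: lexx.
move=> _ [y y0 <-]; rewrite ler_pdivlMl ?mulr_gt0 ?invr_gt0 //.
have P0 := phi_ge0 y; have := phi_ge y (n.+1 * k); rewrite natrM => PL.
rewrite mulrBr.
have -> : n.+1%:R * l^-1 * (l * k%:R * y) = n.+1%:R * k%:R * y :> R.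
  by field; rewrite gt_eqF.
rewrite lerBlDr -lerBlDl; apply: le_trans PL _.
by rewrite ler_peMl // ler_pdivlMr // mul1r.
Qed.

(** Test the conjugate at the point [y] where [phi] is attained at index [j], using (n+1) j <= k and
    l (n+1) >= 1. Monotonicity of [N] ensures [y >= 0]. *)
Lemma weight_omega_ge (l : R) n k : 0 < l -> n.+1%:R^-1 <= l ->
  (forall j, N j <= N j.+1) ->
  N (k %/ n.+1)%N ^+ n.+1 <= weight_omega (assoc_fun N) l k.
Proof.
move=> l0 nl Ninc; set j := (k %/ _)%N.
have [|y y0 Ey] := @phi_attained j; first by rewrite ler_pdivlMr ?mul1r.
rewrite -[leLHS]lnK ?posrE ?exprn_gt0 // lnXn // ler_expR ler_pdivlMl //.
have lk0 : 0 <= l * k%:R by rewrite mulr_ge0 // ltW.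
apply: le_trans (phi_star_ge _ _ lk0 y0).
have P0 := phi_ge0 y.
have -> : ln (N j) = j%:R * y - phi (assoc_fun N) y by rewrite Ey; ring.
rewrite -[_ *+ n.+1]mulr_natl mulrA mulrBr lerB //.
  rewrite -!mulrA ler_pM2l // mulrA ler_wpM2r // -natrM ler_nat mulnC.
  exact: leq_divM.
by rewrite ler_peMl // -ler_pdivrMr // mul1r.
Qed.

(** The two previous bounds meet at [n = 0], [l = 1]: a log-convex sequence is recovered from its
    associated function. *)
Lemma weight_omega1 k : (forall j, N j <= N j.+1) ->
  weight_omega (assoc_fun N) 1 k = N k.
Proof.
move=> Ninc; apply/eqP; rewrite eq_le.
have := @weight_omega_le 1 0 k; rewrite mul1n expr1 => -> //=.
by have := @weight_omega_ge 1 0 k; rewrite divn1 expr1 invr1; apply.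
Qed.

End AssociatedFunction.

(** * Iteration of (mg) *)

Section Matrices.
Context {R : realType} {d : Order.disp_t} {Lambda : porderType d}.
Context {M : Lambda -> nat -> R} (M_wm : weight_matrix M).

Let M_gt0 x k : 0 < M x k. Proof. by case: M_wm => _ _ /(_ x) [+ _ _] _; exact. Qed.
Let M0 x : M x 0%N = 1. Proof. by case: M_wm => _ _ /(_ x) [_ [+ _] _] _. Qed.

(** Each step splits off one block of length [k]; upward directedness merges the two resulting
    indices into one. *)
Lemma mg_roumieu_iter n x : condmg_roumieu M ->
  exists (C : R) y, 0 < C /\ forall k, M x (n * k)%N <= (C ^+ k * M y k) ^+ n.
Proof.
move=> mg; elim: n x => [|n IHn] x.
  by exists 1, x; split=> // k; rewrite mul0n M0 expr0.
have [C [y1 [y2 [C0 mgx]]]] := mg x.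
have [D [y3 [D0 IH]]] := IHn y2.
have [up _ _ mono] := M_wm.
have [y [y1y y3y]] := up y1 y3.
(* [1 + D] dominates both [D] and 1, so all [n.+1] blocks can carry the same factor. *)
exists (C * (1 + D)), y; split=> [|k]; first by rewrite mulr_gt0 // addr_gt0.
rewrite mulSn; apply: le_trans (mgx _ _) _.
have -> : ((C * (1 + D)) ^+ k * M y k) ^+ n.+1 =
    C ^+ (k + n * k) * ((1 + D) ^+ k * M y k) * ((1 + D) ^+ k * M y k) ^+ n.
  rewrite -mulrA -exprS -mulSn (mulnC n.+1) exprM -exprMn mulrA.
  by rewrite -(exprMn k).
have D1 : 1 <= 1 + D by rewrite lerDl ltW.
have ? := ltW (M_gt0 _ _); have ? := ltW C0.
rewrite ler_pM ?mulr_ge0 ?exprn_ge0 //.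
  rewrite ler_wpM2l ?exprn_ge0 //; apply: le_trans (mono _ _ y1y k) _.
  by rewrite ler_peMl // exprn_ege1.
apply: le_trans (IH k) _.
rewrite lerXn2r ?nnegrE ?mulr_ge0 ?exprn_ge0 ?addr_ge0 ?(ltW D0) //.
apply: ler_pM; rewrite ?exprn_ge0 ?(ltW D0) ?mono //.
by rewrite lerXn2r ?nnegrE ?addr_ge0 ?(ltW D0) // lerDr.
Qed.

(** Each step applies (mg) to [x] and the index [z] reached so far. The remainder [i] is kept for a
    later Euclidean division by [n]. *)
Lemma mg_beurling_iter n x : condmg_beurling M ->
  exists (C : R) y, 0 < C /\ forall i k,
    M y (n * k + i)%N <= C ^+ (n * k + i) * M x k ^+ n * M x i.
Proof.
move=> mg; elim: n => [|n [C [z [C0 IH]]]].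
  by exists 1, x; split=> // i k; rewrite mul0n add0n expr0 expr1n !mul1r.
have [D [y [D0 mgy]]] := mg x z.
exists (D * (1 + C)), y; split=> [|i k]; first by rewrite mulr_gt0 // addr_gt0.
rewrite mulSn -addnA; apply: le_trans (mgy _ _) _.
have C1 : 1 <= 1 + C by rewrite lerDl ltW.
have ? := ltW (M_gt0 _ _); have ? := ltW D0; have ? := ltW C0.
rewrite exprMn exprS -!mulrA ler_wpM2l ?exprn_ge0 // mulrCA.
rewrite ler_wpM2l //; apply: le_trans (IH i k) _.
rewrite -mulrA ler_wpM2r ?mulr_ge0 ?exprn_ge0 // [leRHS]exprD.
apply: (@le_trans _ _ ((1 + C) ^+ (n * k + i))).
  by rewrite lerXn2r ?nnegrE ?addr_ge0 // lerDr.
by rewrite ler_peMl ?exprn_ge0 ?addr_ge0 // exprn_ege1.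
Qed.

End Matrices.

(** * Comparison of the weights in the Roumieu and Beurling cases *)

Theorem theorem3p2 (R : realType) (d : Order.disp_t) (Lambda : porderType d)
    (M : Lambda -> nat -> R) (r s : nat) (U : set 'rV[R]_r)
    (M_slc : standard_log_convex M) (r_gt0 : (0 < r)%N) (s_gt0 : (0 < s)%N)
    (U_open : open U) (U_neq0 : U !=set0) :
  (condL_roumieu M -> condmg_roumieu M ->
     E_roumieu M U s = E_omega_roumieu M U s) /\
  (condL_beurling M -> condmg_beurling M ->
     E_beurling M U s = E_omega_beurling M U s).
Proof.
have [M_wm M_LC] := M_slc; have [_ _ M_ws _] := M_wm.
have M_gt0 x k : 0 < M x k by have [+ _ _] := M_ws x; exact.
have M_inc x k : M x k <= M x k.+1 by have [_ _ +] := M_ws x; exact.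
have vM_gt0 x h k : 0 < h -> 0 < weight_M (M x) h k.
  by move=> h0; rewrite mulr_gt0 // exprn_gt0.
split=> L mg; rewrite /E_roumieu /E_omega_roumieu /E_beurling /E_omega_beurling.
- rewrite /roumieu; congr proj_lim; apply/funext => K.
  apply: ind_lim_cofinal => -[x h] /= h0.
    have [D [y [D0 xy]]] := L h x h0.
    (* At [l = 1] the omega weight is [M y] itself, so (L) with constant [h] is the needed bound. *)
    exists (y, 1); first exact: ltr01.
    apply: (weighted_space_embedded _ D0) => k; rewrite ?expR_gt0 ?vM_gt0 //=.
    by rewrite (weight_omega1 (M_LC y) _ (M_inc y)); exact: xy.
  (* Here [h] is the parameter [l] of the omega weight; the weights are compared through their
     [n.+1]-st powers. *)
  pose n := Num.truncn h.
  have hn : h <= n.+1%:R by rewrite ltW // truncnS_gt.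
  have [C [y [C0 xy]]] := mg_roumieu_iter M_wm n.+1 x mg.
  exists (y, C) => //.
  apply: (weighted_space_embedded _ ltr01) => k; rewrite ?expR_gt0 ?vM_gt0 //=.
  rewrite mul1r -(@ler_pXn2r _ n.+1) ?nnegrE ?expR_ge0 ?(ltW (vM_gt0 _ _ _ _)) //.
  apply: le_trans (xy k); exact: (weight_omega_le (M_LC x)).
- rewrite /beurling; congr proj_lim; apply/funext => K.
  apply: proj_lim_cofinal => -[x h] /= h0.
    pose n := Num.truncn h^-1.
    have nh : n.+1%:R^-1 <= h.
      by rewrite invf_ple ?posrE // ltW // truncnS_gt.
    have [C [y [C0 xy]]] := mg_beurling_iter M_wm n.+1 x mg.
    (* The parameter [C^-1] cancels the factor [C ^+ k] from (mg), and the constant [M x n.+1]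
       dominates [M x i] for every remainder [i] modulo [n.+1]. *)
    exists (y, C^-1); first by rewrite /parameters /= invr_gt0.
    apply: (weighted_space_embedded _ (M_gt0 x n.+1)) => k;
      rewrite ?expR_gt0 ?vM_gt0 ?invr_gt0 //=.
    have := xy (k %% n.+1)%N (k %/ n.+1)%N.
    rewrite (mulnC n.+1) -divn_eq -mulrA => le_k.
    rewrite /weight_M exprVn ler_pdivrMl ?exprn_gt0 //.
    apply: le_trans le_k _; rewrite ler_pM2l ?exprn_gt0 // mulrC.
    apply: ler_pM; rewrite ?exprn_ge0 ?(ltW (M_gt0 _ _)) //.
      apply: (@homo_leq _ _ <=%R) => //; first exact: le_trans.
      by rewrite ltnW // ltn_mod.
    exact: (weight_omega_ge (M_LC x)).
  have hV0 : 0 < h^-1 by rewrite invr_gt0.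
  (* The inverse appears because [h ^+ k] now sits on the larger side. *)
  have [D [y [D0 xy]]] := L h^-1 x hV0.
  exists (y, 1); first exact: ltr01.
  apply: (weighted_space_embedded _ D0) => k; rewrite ?expR_gt0 ?vM_gt0 //=.
  rewrite (weight_omega1 (M_LC y) _ (M_inc y)) /weight_M mulrCA.
  by rewrite -ler_pdivrMl ?exprn_gt0 // -exprVn.
Qed.
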